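(* Let $A$ and $B$ be finite subsets of an abelian group $G$, satisfying $|A+B|\le |A|+|B|-1$ and such that $A$ is non-empty, $|B|\ge 2$, and $|A+B|\le |G|-2$. Then at least one of the following holds: (i) there exists a finite, non-zero subgroup $H<G$ such that $|A+H|-|A|\le |H|-1$ and $A+H\neq G$; (ii) there exist a non-zero subgroup $H\le G$ of finite index $n:=[G:H]$, elements $g_1,\ldots,g_{n-1}\in G$, and an arithmetic progression $A_0\subseteq A$, such that $A$ is the disjoint union $A=A_0\cup(g_1+H)\cup\dots\cup(g_{n-1}+H)$.
   Context: Groups are abelian and written additively, and $G$ may be infinite (in which case $|A+B|\le|G|-2$ holds automatically); $A+B:=\{a+b: a\in A,\ b\in B\}$. An arithmetic progression in $G$ with difference $d\in G$ is a set of the form $\{g+d,g+2d,\ldots,g+kd\}$ with $g\in G$ and $k$ a positive integer not exceeding the order of $d$ in $G$ (so one-element sets and cosets of finite cyclic subgroups are arithmetic progressions; the empty set is not). *)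

(* Defs.v *)
From HB Require Import structures.
From mathcomp Require Import all_boot all_order all_algebra.
From mathcomp Require Import finmap.
From mathcomp Require Import boolp classical_sets functions cardinality.

Set Implicit Arguments.
Unset Strict Implicit.
Unset Printing Implicit Defensive.

Import Order.TTheory GRing.Theory.
Local Open Scope fset_scope.
Local Open Scope classical_set_scope.
Local Open Scope ring_scope.

Definition sumset (G : zmodType) (A B : {fset G}) : {fset G} :=
  [fset a + b | a in A, b in B].

Definition subgroup (G : zmodType) (H : set G) : Prop :=
  zmod_closed [pred x | x \in H].

Definition coset (G : zmodType) (g : G) (H : set G) : set G :=
  [set g + h | h in H].

Definition cosets (G : zmodType) (H : set G) : set (set G) :=
  range (fun g => coset g H).

Definition has_index (G : zmodType) (H : set G) (n : nat) : Prop :=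
  (cosets H #= `I_n)%card.

(* No [n] satisfies this when [d] has infinite order. *)
Definition has_order (G : zmodType) (d : G) (n : nat) : Prop :=
  [/\ (0 < n)%N, d *+ n = 0
    & forall m : nat, (0 < m)%N -> d *+ m = 0 -> (n <= m)%N].

Definition arith_prog (G : zmodType) (S : set G) : Prop :=
  exists (g d : G) (k : nat),
    [/\ (0 < k)%N,
        forall n : nat, has_order d n -> (k <= n)%N
      & S = [set g + d *+ i | i in [set i : nat | (1 <= i <= k)%N]]].

(* Main.v *)
Require Import Defs.
From HB Require Import structures.
From mathcomp Require Import all_boot all_order all_algebra.
From mathcomp Require Import finmap zify.
From mathcomp Require Import boolp classical_sets functions cardinality.

(** The proof follows the isoperimetric method of Hamidoune. For a finite set [X]
    consider the excess [#|X + A| - #|X|], and among the sets [X] with at least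
    two elements such that [X + A] misses at least two elements of the group,
    call an atom of [A] a smallest one of least excess. The set [B] of the
    theorem has excess at most [#|A| - 1], hence so has an atom [M].

    The excess is submodular, and the complement of [X + A] gives, up to sign, a
    set of no larger excess; this forces two distinct translates of an atom to
    meet in at most one point ([atom_shift_eq]). Consequently an atom containing
    [0] is either a subgroup or a Sidon set ([atom_subgroup_or_sidon]).

    - If [M] is a subgroup, it is the subgroup of the first alternative.
    - If [M] has two elements [0] and [d], then [A + d] has at most one point
      outside [A]. So [A] is a union of cosets of the subgroup generated by [d]
      and of at most one progression of difference [d], and one of the two
      alternatives holds ([nearly_stable_structure]).
    - If [M] is a Sidon set with at least three elements, let [K] be the subgroup
      it generates. Sidon sets have large sumsets ([sidon_sumset_large]). So if
      [X] has at least two points in [K] and [#|X + M| < #|X| + #|M|], then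
      [X + M] misses at most one point of [K]: otherwise the dichotomy, applied
      to an atom of [M] inside [K], would give a subgroup smaller than [K] and
      containing [M] ([sidon_in_proper_subgroup]). For the pieces of [A] in the
      cosets of [K], this leaves two possibilities ([sidon_atom]): [K] is finite
      and [A] fills all but fewer than [#|K|] points of a proper union of cosets
      of [K]; or [A] is one point together with full cosets of [K], and then [A]
      is nearly stable under translation by any element of [M], as in the
      previous case. *)

Set Implicit Arguments.
Unset Strict Implicit.
Unset Printing Implicit Defensive.

Import Order.TTheory GRing.Theory.
Local Open Scope fset_scope.
Local Open Scope classical_set_scope.
Local Open Scope ring_scope.

(** * Sumsets, translates and subgroups *)

Lemma mem_sumset (G : zmodType) (A B : {fset G}) x :
  x \in sumset A B <-> exists a b, [/\ a \in A, b \in B & x = a + b].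
Proof.
split=> [/imfset2P[a aA [b bB ->]]|[a [b [aA bB ->]]]]; first by exists a, b.
exact: in_imfset2.
Qed.

Definition shift (G : zmodType) (A : {fset G}) (x : G) : {fset G} :=
  [fset a + x | a in A].

Lemma mem_shift (G : zmodType) (A : {fset G}) x y :
  (y \in shift A x) = (y - x \in A).
Proof.
apply/imfsetP/idP => [[a aA ->]|yA]; first by rewrite addrK.
by exists (y - x) => //; rewrite subrK.
Qed.

Lemma card_shift (G : zmodType) (A : {fset G}) x : #|` shift A x| = #|` A|.
Proof. by rewrite card_imfset //; apply: addIr. Qed.

Lemma sumset_subset (G : zmodType) (A A' B B' : {fset G}) :
  (A `<=` A')%fset -> (B `<=` B')%fset -> (sumset A B `<=` sumset A' B')%fset.
Proof.
move=> /fsubsetP sA /fsubsetP sB; apply/fsubsetP => x /mem_sumset.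
by move=> [a [b [/sA aA /sB bB ->]]]; apply/mem_sumset; exists a, b.
Qed.

Lemma sumsetC (G : zmodType) (A B : {fset G}) : sumset A B = sumset B A.
Proof.
apply/fsetP => x; apply/idP/idP => /mem_sumset[a [b [aA bB ->]]];
by apply/mem_sumset; exists b, a; rewrite addrC.
Qed.

Lemma shift_sub_sumset (G : zmodType) (A B : {fset G}) x :
  x \in B -> (shift A x `<=` sumset A B)%fset.
Proof.
move=> xB; apply/fsubsetP => y; rewrite mem_shift => yA.
by apply/mem_sumset; exists (y - x), x; rewrite subrK.
Qed.

Lemma sub_sumset (G : zmodType) (A B : {fset G}) :
  0 \in B -> (A `<=` sumset A B)%fset.
Proof.
by move=> B0; apply/fsubsetP => x xA; apply/mem_sumset; exists x, 0; rewrite addr0.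
Qed.

Lemma leq_sumsetl (G : zmodType) (A B : {fset G}) :
  B != fset0 -> (#|` A| <= #|` sumset A B|)%N.
Proof.
by move=> /fset0Pn[x xB]; rewrite -(card_shift A x) fsubset_leq_card ?shift_sub_sumset.
Qed.

Lemma sumset_shiftl (G : zmodType) (A B : {fset G}) x :
  sumset (shift A x) B = shift (sumset A B) x.
Proof.
apply/fsetP => y; rewrite mem_shift; apply/idP/idP => /mem_sumset[a [b [aA bB yE]]].
  apply/mem_sumset; exists (a - x), b; rewrite -mem_shift; split=> //.
  by rewrite yE addrAC.
apply/mem_sumset; exists (a + x), b; rewrite mem_shift addrK; split=> //.
by rewrite addrAC -yE subrK.
Qed.

Lemma sumsetU (G : zmodType) (X Y A : {fset G}) :
  sumset (X `|` Y)%fset A = (sumset X A `|` sumset Y A)%fset.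
Proof.
apply/fsetP => x; rewrite inE; apply/idP/orP.
  move=> /mem_sumset[a [b [+ bA ->]]]; rewrite inE => /orP[aX|aY]; [left|right];
  by apply/mem_sumset; exists a, b.
by move=> [] /mem_sumset[a [b [aX bA ->]]]; apply/mem_sumset; exists a, b;
  rewrite inE aX ?orbT.
Qed.

Lemma sumset_submodular (G : zmodType) (X Y A : {fset G}) :
  (#|` sumset (X `|` Y)%fset A| + #|` sumset (X `&` Y)%fset A|
   <= #|` sumset X A| + #|` sumset Y A|)%N.
Proof.
rewrite sumsetU -[leqRHS]cardfsUI leq_add2l fsubset_leq_card // fsubsetI.
by rewrite !sumset_subset ?fsubsetIl ?fsubsetIr.
Qed.

Lemma subgroupP (G : zmodType) (U : set G) : subgroup U ->
  [/\ U 0, forall x, U x -> U (- x) & forall x y, U x -> U y -> U (x + y)].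
Proof.
case=> U0 UB; have {}U0 : U 0 by move: U0; rewrite !inE.
have {}UB x y : U x -> U y -> U (x - y).
  by move=> Ux Uy; have := UB x y; rewrite !inE; apply.
have UN x : U x -> U (- x) by move=> Ux; rewrite -sub0r; apply: UB.
by split=> // x y Ux Uy; rewrite -[y]opprK; apply/UB => //; apply: UN.
Qed.

Lemma subgroupI (G : zmodType) (U : set G) :
  U 0 -> (forall x y, U x -> U y -> U (x - y)) -> subgroup U.
Proof. by move=> U0 UB; split=> [|x y]; rewrite !inE //; apply: UB. Qed.

Lemma subgroupT (G : zmodType) : subgroup [set: G].
Proof. exact: subgroupI. Qed.

(** * Atoms *)

(** The condition [room U n] says that a subset of [U] of size [n] misses at
    least two elements of [U]; it is vacuous when [U] is infinite. *)
Definition room (G : zmodType) (U : set G) (n : nat) : Prop :=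
  finite_set U -> (n + 2 <= #|` fset_set U|)%N.

Lemma room_le (G : zmodType) (U : set G) m n : (m <= n)%N -> room U n -> room U m.
Proof. by move=> mn rn /rn; apply: leq_trans; rewrite leq_add2r. Qed.

(** The ambient subgroup [U] is a parameter because atoms are taken twice: those
    of [A] in the whole group, then those of an atom [M] in the subgroup that
    [M] generates. *)
Definition separated (G : zmodType) (U : set G) (A X : {fset G}) : Prop :=
  [/\ [set` X] `<=` U, (2 <= #|` X|)%N & room U #|` sumset X A|].

Definition excess (G : zmodType) (A X : {fset G}) : nat :=
  (#|` sumset X A| - #|` X|)%N.

(** These are the 2-atoms of the isoperimetric method: the smallest sets among
    those that minimize the excess. *)
Definition atom (G : zmodType) (U : set G) (A M : {fset G}) : Prop :=
  separated U A M /\ forall X, separated U A X ->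
    (excess A M < excess A X)%N \/
    excess A M = excess A X /\ (#|` M| <= #|` X|)%N.

Lemma exists_minimizer (T : Type) (P : T -> Prop) (mu : T -> nat) :
  (exists x, P x) -> exists2 x, P x & forall y, P y -> (mu x <= mu y)%N.
Proof.
move=> [x0 Px0]; have ex : exists n, `[< exists2 x, P x & mu x = n >].
  by exists (mu x0); apply/asboolP; exists x0.
have [n /asboolP[x Px xn] nmin] := ex_minnP ex.
by exists x => // y Py; rewrite xn; apply/nmin/asboolP; exists y.
Qed.

Lemma exists_atom (G : zmodType) (U : set G) (A X : {fset G}) :
  separated U A X -> exists M : {fset G}, atom U A M.
Proof.
move=> sX; have [|Y sY Ymin] := @exists_minimizer _ (separated U A) (excess A).
  by exists X.
have [|M [sM eM] Mmin] := @exists_minimizer _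
  (fun Z => separated U A Z /\ excess A Z = excess A Y) (fun Z => #|` Z|).
  by exists Y.
exists M; split=> // Z sZ; rewrite eM.
have := Ymin Z sZ; rewrite leq_eqVlt => /orP[/eqP e|]; last by left.
by right; split=> //; apply: Mmin.
Qed.

(** If [M] is an atom of [A], then the negative of the complement of [M + A] in
    [U] is again separated, and its excess is at most that of [M]: its sum with
    [A] avoids [- M]. Minimality of [M] therefore bounds [#|M|] by the size of
    that complement. *)
Lemma leq_codim_atom (G : zmodType) (U : set G) (A M : {fset G}) :
  subgroup U -> [set` A] `<=` U -> A != fset0 -> atom U A M -> finite_set U ->
  (#|` sumset M A| + #|` M| <= #|` fset_set U|)%N.
Proof.
move=> /subgroupP[U0 UN UD] sAU A0 [[sMU M2 rM] Mmin] finU.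
have sMAU : (sumset M A `<=` fset_set U)%fset.
  apply/fsubsetP => x /mem_sumset[m [a [mM aA ->]]].
  by rewrite in_fset_set // inE; apply: UD; [apply: sMU|apply: sAU].
have rM' := rM finU.
pose C := (fset_set U `\` sumset M A)%fset.
pose X : {fset G} := [fset - c | c in C].
have cX : #|` X| = (#|` fset_set U| - #|` sumset M A|)%N.
  rewrite card_imfset; last exact: oppr_inj.
  by rewrite cardfsD (fsetIidPr sMAU).
pose M' : {fset G} := [fset - m | m in M].
have cM' : #|` M'| = #|` M| by rewrite card_imfset //; apply: oppr_inj.
have sXA : (sumset X A `<=` fset_set U `\` M')%fset.
  apply/fsubsetP => y /mem_sumset[x [a [/imfsetP[c /=]]]].
  rewrite in_fsetD => /andP[cMA cU] -> aA ->.
  rewrite in_fsetD in_fset_set //; apply/andP; split; last first.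
    rewrite inE; apply: UD; last exact: sAU.
    by apply: UN; move: cU; rewrite in_fset_set // inE.
  apply: contra cMA => /imfsetP[m /= mM e]; apply/mem_sumset; exists m, a.
  by split=> //; rewrite -[m]opprK -e opprD opprK addrNK.
have sM'U : (M' `<=` fset_set U)%fset.
  apply/fsubsetP => x /imfsetP[m /= mM ->]; rewrite in_fset_set // inE.
  by apply/UN/sMU.
have := fsubset_leq_card sXA; rewrite cardfsD (fsetIidPr sM'U) cM' => cXA.
have := fsubset_leq_card sM'U; rewrite cM' => MU.
have MMA := leq_sumsetl M A0; have XXA := leq_sumsetl X A0.
have sX : separated U A X.
  split=> [x /=|| _]; try lia.
  move=> /imfsetP[c /=]; rewrite in_fsetD => /andP[_ +] ->.
  by rewrite in_fset_set // inE; apply: UN.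
have := Mmin X sX; rewrite /excess; lia.
Qed.

(** Submodularity of the excess: if [M] and [M + x] were distinct with at least
    two common points, their intersection would be a smaller separated set, hence
    of larger excess than [M], and so their union would have excess smaller than
    [M]. The union is then not separated, so its sum with [A] misses at most
    one point of [U]. But the union has at most [2 #|M| - 2] elements, which is
    too few by the bound on the size of an atom. *)
Lemma atom_shift_eq (G : zmodType) (U : set G) (A M : {fset G}) x :
  subgroup U -> [set` A] `<=` U -> A != fset0 -> atom U A M ->
  (2 <= #|` (M `&` shift M x)%fset|)%N -> shift M x = M.
Proof.
move=> gU sAU A0 aM I2; have codim := leq_codim_atom gU sAU A0 aM.
have [U0 UN UD] := subgroupP gU; have [[sMU M2 rM] Mmin] := aM.
set I := (M `&` shift M x)%fset in I2; set V := (M `|` shift M x)%fset.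
have sIM : (I `<=` M)%fset by apply: fsubsetIl.
have cVI : (#|` V| + #|` I| = 2 * #|` M|)%N.
  by rewrite cardfsUI card_shift mul2n addnn.
have subm : (#|` sumset V A| + #|` sumset I A| <= 2 * #|` sumset M A|)%N.
  apply: leq_trans (sumset_submodular _ _ _) _.
  by rewrite sumset_shiftl card_shift mul2n addnn.
have [IM|IM] := eqVneq I M.
  have /fsubset_leqif_cards[_ +] : (M `<=` shift M x)%fset.
    by rewrite -{1}IM; apply: fsubsetIr.
  by rewrite card_shift eqxx => /esym/eqP.
have ltIM : (#|` I| < #|` M|)%N by rewrite fproper_ltn_card // fproperEneq IM.
have sI : separated U A I.
  split=> //; first by apply: subset_trans sMU => z; apply: (fsubsetP sIM).
  by apply: room_le rM; apply/fsubset_leq_card/sumset_subset.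
have Ux : U x.
  have /fset0Pn[y] : I != fset0 by rewrite -cardfs_gt0; lia.
  rewrite inE mem_shift => /andP[yM yxM].
  have -> : x = - (y - x) + y by rewrite opprB addrNK.
  by apply: UD; [apply/UN/sMU|apply/sMU].
have eI := Mmin I sI.
have MMA := leq_sumsetl M A0; have VVA := leq_sumsetl V A0.
have IIA := leq_sumsetl I A0.
have sV : ~ separated U A V by move=> /Mmin; move: eI; rewrite /excess; lia.
(* It remains to find room for the sum of [V] with [A]. *)
exfalso; apply: sV; split=> [y /=||finU]; [|lia|].
    rewrite inE mem_shift => /orP[/sMU//|yM].
  by rewrite -(subrK x y); apply: UD => //; apply: sMU.
have := codim finU; have := rM finU; move: eI; rewrite /excess; lia.
Qed.

(** No nonzero element is a difference of elements of [M] in two ways; this is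
    the form in which atoms satisfy the condition. *)
Definition sidon (G : zmodType) (M : {fset G}) : Prop :=
  forall x, x != 0 -> (#|` (M `&` shift M x)%fset| <= 1)%N.

Lemma atom_shift (G : zmodType) (U : set G) (A M : {fset G}) x :
  subgroup U -> U x -> atom U A M -> atom U A (shift M x).
Proof.
move=> /subgroupP[U0 UN UD] Ux [[sMU M2 rM] Mmin].
have ex : excess A (shift M x) = excess A M.
  by rewrite /excess sumset_shiftl !card_shift.
split; last by rewrite ex card_shift.
split; rewrite ?sumset_shiftl ?card_shift // => y /=; rewrite mem_shift => yM.
by rewrite -(subrK x y); apply: UD => //; apply: sMU.
Qed.

(** Translate an atom so that it contains [0]. If it is not a Sidon set, two of
    its points lie in a nontrivial translate, so it has a nonzero period [x]. For
    every [y] in [M], the points [y] and [y + x] lie in both [M] and [M + y], so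
    [y] is a period as well: [M] is a subgroup. *)
Lemma atom_subgroup_or_sidon (G : zmodType) (U : set G) (A X : {fset G}) :
  subgroup U -> [set` A] `<=` U -> A != fset0 -> separated U A X ->
  exists M : {fset G}, [/\ 0 \in M, separated U A M, (excess A M <= excess A X)%N
              & subgroup [set` M] \/ sidon M].
Proof.
move=> gU sAU A0 sX; have [N aN] := exists_atom sX.
have [U0 UN UD] := subgroupP gU.
have /fset0Pn[n nN] : N != fset0 by rewrite -cardfs_gt0; have [[]] := aN; lia.
pose M := shift N (- n).
have aM : atom U A M by apply: atom_shift => //; apply/UN; have [[+ _ _] _] := aN; apply.
have M0 : 0 \in M by rewrite mem_shift opprK add0r.
exists M; split=> //; first by case: aM.
  by have [_ /(_ X sX)] := aM; lia.
have [|nS] := pselect (sidon M); [by right|left].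
have [x x0 xM] : exists2 x, x != 0 & shift M x = M.
  apply: contrapT => nex; apply: nS => x x0; rewrite leqNgt; apply/negP => I2.
  by apply: nex; exists x => //; apply: (atom_shift_eq gU sAU A0 aM).
(* A single nonzero period propagates to a period for each point. *)
have Mx y : y \in M -> y + x \in M by move=> yM; rewrite -xM mem_shift addrK.
have per y : y \in M -> shift M y = M.
  move=> yM; apply: (atom_shift_eq gU sAU A0 aM).
  have : ([fset y; (y + x)%R] `<=` M `&` shift M y)%fset.
    apply/fsubsetP => z; rewrite !inE mem_shift => /orP[] /eqP ->.
      by rewrite yM subrr M0.
    by rewrite Mx // addrAC subrr Mx.
  move=> /fsubset_leq_card; apply: leq_trans; rewrite cardfs2.
  by rewrite -[X in X == _]addr0 (inj_eq (addrI y)) eq_sym x0.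
apply: subgroupI => //= y z yM zM.
by rewrite -mem_shift per.
Qed.

(** * Sumsets of Sidon sets *)

Lemma sumset_fset1U (G : zmodType) (M N : {fset G}) x :
  sumset M (x |` N)%fset = (shift M x `|` sumset M N)%fset.
Proof.
rewrite ![sumset M _]sumsetC sumsetU; congr (_ `|` _)%fset.
apply/fsetP => y; rewrite mem_shift; apply/idP/idP.
  by move=> /mem_sumset[z [m [/fset1P-> mM ->]]]; rewrite addrAC subrr add0r.
by move=> yM; apply/mem_sumset; exists x, (y - x); rewrite fset11 addrCA subrr addr0.
Qed.

Lemma sidon_meet_sumset (G : zmodType) (M N : {fset G}) x :
  sidon M -> x \notin N -> (#|` (shift M x `&` sumset M N)%fset| <= #|` N|)%N.
Proof.
move=> sM; elim/fset1U_rect: N => [_|z N zN IH].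
  have -> : sumset M fset0 = fset0.
    by apply/fsetP => y; rewrite inE; apply/idP => /mem_sumset[m [z []]].
  by rewrite fsetI0.
rewrite in_fset1U negb_or => /andP[xz /IH{}IH].
rewrite sumset_fset1U fsetIUr cardfsU1 zN add1n.
suff : (#|` (shift M x `&` shift M z)%fset| <= 1)%N by rewrite cardfsU; lia.
have /sM : z - x != 0 by rewrite subr_eq0 eq_sym.
congr (_ <= _)%N; rewrite -(card_shift _ x); congr #|` _|; apply/fsetP => y.
by rewrite mem_shift !inE !mem_shift opprB addrA subrK.
Qed.

(** Adding one point to [N] adds to the sumset a translate of [M], which meets
    each of the [#|N|] earlier translates at most once. *)
Lemma sidon_sumset (G : zmodType) (M N : {fset G}) : sidon M ->
  (#|` M| * #|` N| <= #|` sumset M N| + 'C(#|` N|, 2))%N.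
Proof.
move=> sM; elim/fset1U_rect: N => [|x N xN IH]; first by rewrite cardfs0 muln0.
have := sidon_meet_sumset sM xN.
rewrite cardfsU1 xN add1n binS bin1 sumset_fset1U cardfsU card_shift mulnS.
have := fsubset_leq_card (fsubsetIl (shift M x) (sumset M N)).
by rewrite card_shift; lia.
Qed.

Lemma sidon_sumset_large (G : zmodType) (M N : {fset G}) : sidon M ->
  (3 <= #|` M|)%N -> (2 <= #|` N| <= #|` M|)%N ->
  (#|` M| + #|` N| <= #|` sumset M N|)%N.
Proof.
move=> sM M3 /andP[N2 NM]; have := sidon_sumset N sM.
have := bin_ffact #|` N| 2; rewrite ffactnS ffactn1 (_ : 2`! = 2)%N // => h h'.
have : (2 * (#|` M| * #|` N|) <= 2 * #|` sumset M N| + #|` N| * #|` N|.-1)%N.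
  by rewrite -h; lia.
move: N2 NM M3; case: #|` N| => [|[|n]] //=; case: (#|` M|)%N => // m.
nia.
Qed.

(** Take an atom [N] of [M] inside [K]. It is not Sidon: for two Sidon sets of
    which the larger has at least three elements, the sumset is too large. So [N]
    is a subgroup, and it is larger than [M] for the same reason. Since [M + N] is
    a union of cosets of [N] with fewer than [2 #|N|] elements, [M] lies in [N]. *)
Lemma sidon_in_proper_subgroup (G : zmodType) (K : set G) (M X : {fset G}) :
  subgroup K -> [set` M] `<=` K -> 0 \in M -> sidon M -> (3 <= #|` M|)%N ->
  separated K M X -> (#|` sumset X M| < #|` X| + #|` M|)%N ->
  exists H : {fset G}, [/\ subgroup [set` H], (M `<=` H)%fset & [set` H] `<` K].
Proof.
move=> gK sMK M0 sM M3 sX cX.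
have Mn : M != fset0 by apply/fset0Pn; exists 0.
have [N [N0 [sNK N2 rN] eN NH]] := atom_subgroup_or_sidon gK sMK Mn sX.
have {}eN : (#|` sumset N M| < #|` N| + #|` M|)%N.
  by have := leq_sumsetl N Mn; have := leq_sumsetl X Mn; move: eN; rewrite /excess; lia.
have ltMN : (#|` M| < #|` N|)%N.
  rewrite ltnNge; apply/negP => NM; have := sidon_sumset_large sM M3 (N := N).
  by rewrite sumsetC N2 NM => /(_ isT); lia.
case: NH => [gN|sN]; last first.
  have := sidon_sumset_large sN (N := M).
  by rewrite (ltnW ltMN) (ltn_trans _ M3) // andbT => /(_ _ isT); lia.
exists N; split=> //; last first.
  split=> // KN; have KE : K = [set` N] by apply/seteqP.
  have := rN; rewrite KE /room set_fsetK => /(_ (finite_fset _)).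
  by have := leq_sumsetl N Mn; lia.
have [_ NN ND] := subgroupP gN.
apply/fsubsetP => y yM; apply: contraT => yN.
have sub : (N `|` shift N y `<=` sumset N M)%fset.
  by apply/fsubUsetP; split; [apply: sub_sumset|apply: shift_sub_sumset].
have dis : (N `&` shift N y)%fset = fset0.
  apply/fsetP => z; rewrite !inE mem_shift; apply/negP => /andP[zN zyN].
  move/negP: yN; apply; have -> : y = - (z - y) + z by rewrite opprB subrK.
  by apply: ND => //; apply: NN.
have := fsubset_leq_card sub; rewrite cardfsU dis cardfs0 card_shift; lia.
Qed.

(** * Sets whose sum with a Sidon set is small *)

Definition generated (G : zmodType) (M : {fset G}) : set G :=
  [set x | forall U, subgroup U -> [set` M] `<=` U -> U x].

Lemma subgroup_generated (G : zmodType) (M : {fset G}) : subgroup (generated M).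
Proof.
apply: subgroupI => [U gU sMU|x y Kx Ky U gU sMU]; have [U0 UN UD] := subgroupP gU => //.
by apply: UD; [exact: Kx|apply: UN; exact: Ky].
Qed.

Lemma sub_generated (G : zmodType) (M : {fset G}) : [set` M] `<=` generated M.
Proof. by move=> x Mx U _; apply. Qed.

Lemma subgroup_stabilizer (G : zmodType) (R : {fset G}) :
  subgroup [set x | shift R x = R].
Proof.
have shiftP (x y : G) : shift (shift R x) y = shift R (x + y).
  by apply/fsetP => z; rewrite !mem_shift opprD addrA addrAC.
have R0 : shift R 0 = R by apply/fsetP => z; rewrite mem_shift subr0.
apply: subgroupI => //= x y Rx Ry.
by rewrite -shiftP Rx -{1}Ry shiftP subrr.
Qed.

(** Equality in [#|R| <= #|R + M|] makes each point of [M] a period of [R], and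
    the periods of [R] form a subgroup. *)
Lemma sumset_eq_periodic (G : zmodType) (M R : {fset G}) : 0 \in M ->
  (#|` sumset R M| <= #|` R|)%N ->
  forall x, generated M x -> shift R x = R.
Proof.
move=> M0 cR x Kx; apply: (Kx _ (subgroup_stabilizer R)) => m /= mM.
have RM z : z \in M -> shift R z = sumset R M.
  move=> zM; apply/eqP; rewrite eqEfcard shift_sub_sumset // card_shift.
  exact: cR.
have R0 : shift R 0 = R by apply/fsetP => z; rewrite mem_shift subr0.
by rewrite (RM m mM) -(RM 0 M0) R0.
Qed.

(** Equivalently, [A] lies in a union of cosets of [H] that is not the whole
    group, and misses fewer than [#|H|] points of that union. *)
Definition nearly_periodic (G : zmodType) (A : {fset G}) : Prop :=
  exists H : {fset G}, [/\ subgroup [set` H], exists2 h, h \in H & h != 0,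
    (#|` sumset A H| < #|` A| + #|` H|)%N & exists x, x \notin sumset A H].

Definition nearly_stable (G : zmodType) (A : {fset G}) : Prop :=
  exists2 d : G, d != 0 & (#|` (shift A d `\` A)%fset| <= 1)%N.

Lemma room_notin (G : zmodType) (S : {fset G}) n :
  room [set: G] n -> (#|` S| <= n.+1)%N -> exists x, x \notin S.
Proof.
move=> rn Sn; apply: contrapT => nex.
have ST : [set: G] = [set` S].
  apply/seteqP; split=> // x _ /=; apply: contraT => xS.
  by case: nex; exists x.
have := rn; rewrite ST /room set_fsetK => /(_ (finite_fset _)); lia.
Qed.

Lemma exists_nonzero (G : zmodType) (M : {fset G}) :
  (2 <= #|` M|)%N -> exists2 d, d \in M & d != 0.
Proof.
move=> M2; have /fset0Pn[d] : (M `\ 0%R)%fset != fset0.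
  by rewrite -cardfs_gt0; move: M2; rewrite (cardfsD1 0); case: (_ \in _) => //= /ltnW.
by rewrite !inE => /andP[d0 dM]; exists d.
Qed.

(** Let [M] be a Sidon set containing [0] with at least three points, let [K] be
    the subgroup it generates, and cut [A] along the cosets of [K]: [C a] is the
    part of [A] in the coset of [a], and [R a] is the rest. Since [M] lies in
    [K], the sum with [M] respects this partition. *)
Section SidonAtom.
Variables (G : zmodType) (A M : {fset G}).
Hypotheses (M0 : 0 \in M) (sM : sidon M) (M3 : (3 <= #|` M|)%N).

Let K := generated M.
Let in_coset (a x : G) := `[< K (x - a) >].
Let C a := [fset x in A | in_coset a x]%fset.
Let R a := [fset x in A | ~~ in_coset a x]%fset.

Let Mn0 : M != fset0. Proof. by apply/fset0Pn; exists 0. Qed.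
Let K0 : K 0. Proof. by have [] := subgroupP (subgroup_generated M). Qed.
Let KN x : K x -> K (- x).
Proof. by have [_ + _] := subgroupP (subgroup_generated M); apply. Qed.
Let KD x y : K x -> K y -> K (x + y).
Proof. by have [_ _] := subgroupP (subgroup_generated M); apply. Qed.
Let MK x : x \in M -> K x. Proof. exact: sub_generated. Qed.

Let card_split a : #|` A| = (#|` C a| + #|` R a|)%N.
Proof.
rewrite -cardfsUI; have -> : (C a `&` R a)%fset = fset0.
  by apply/fsetP => x; rewrite !inE /=; case: (in_coset a x); rewrite !andbF.
rewrite cardfs0 addn0; congr #|` _|.
by apply/fsetP => x; rewrite !inE /=; case: (in_coset a x);
  rewrite /= ?andbT ?andbF ?orbF.
Qed.

Let card_sumset_split a :
  #|` sumset A M| = (#|` sumset (C a) M| + #|` sumset (R a) M|)%N.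
Proof.
rewrite -cardfsUI -sumsetU.
have -> : (sumset (C a) M `&` sumset (R a) M)%fset = fset0.
  apply/fsetP => x; rewrite inE in_fset0; apply/negP.
  move=> /andP[/mem_sumset[y [m [+ mM xE]]] /mem_sumset[z [l [+ lM xE']]]].
  rewrite !inE /= => /andP[_ /asboolP yK] /andP[_ /asboolP zK]; apply: zK.
  have -> : z - a = (m - l) + (y - a).
    by rewrite addrA; congr (_ - _); rewrite addrAC [m + y]addrC -xE xE' addrK.
  exact: KD (KD (MK mM) (KN (MK lM))) yK.
rewrite cardfs0 addn0; congr #|` sumset _ _|.
by apply/fsetP => x; rewrite !inE /=; case: (in_coset a x);
  rewrite /= ?andbT ?andbF ?orbF.
Qed.

(** No proper subgroup of [K] contains [M], so a part of [A] with at least two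
    points and a small sum with [M] must fill its coset up to one point. *)
Let coset_large a : (2 <= #|` C a|)%N ->
  (#|` sumset (C a) M| < #|` C a| + #|` M|)%N ->
  finite_set K /\ (#|` fset_set K| <= #|` sumset (C a) M|.+1)%N.
Proof.
move=> C2 CM; apply: contrapT => nK.
have [||H [gH MH [_ []]]] := @sidon_in_proper_subgroup G K M (shift (C a) (- a))
  (subgroup_generated M) (@sub_generated _ M) M0 sM M3.
- split=> [x /=||finK]; rewrite ?card_shift //.
    by rewrite mem_shift opprK !inE /= => /andP[_ /asboolP]; rewrite addrK.
  rewrite sumset_shiftl card_shift; rewrite leqNgt; apply/negP => lt.
  by apply: nK; split=> //; lia.
- by rewrite sumset_shiftl !card_shift.
move=> x Kx; apply: (Kx _ gH) => m; exact: (fsubsetP MH).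
Qed.

(** If for some [a] the part [C a] alone accounts for the whole excess, the rest
    of [A] is a union of cosets of [K], and [C a] is either one point, so that
    translating by an element of [M] moves [A] by one point, or almost fills its
    coset after adding [M]. If no part does, every coset of [K] that meets [A] is
    contained in [A + M]: a missing point [y] would keep [y - M], with its [#|M|]
    points, disjoint from the part of [A] in that coset. *)
Lemma sidon_atom : A != fset0 -> (#|` sumset A M| < #|` A| + #|` M|)%N ->
  room [set: G] #|` sumset A M| -> nearly_periodic A \/ nearly_stable A.
Proof.
move=> An0 cAM rAM.
have Ca a : a \in A -> a \in C a.
  by move=> aA; rewrite !inE /= aA; apply/asboolP; rewrite subrr; exact: K0.
have [d dM d0] := exists_nonzero (ltnW M3).
have subK : finite_set K -> forall a x, (x \in shift (fset_set K) a) = `[< K (x - a) >].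
  by move=> finK a x; rewrite mem_shift in_fset_set // in_setE.
have gK : finite_set K -> subgroup [set` fset_set K].
  by move=> finK; rewrite fset_setK //; apply: subgroup_generated.
have dK : finite_set K -> d \in fset_set K.
  by move=> finK; rewrite in_fset_set // inE; exact: MK.
have [[a aA aC]|all_small] := pselect (exists2 a, a \in A &
    (#|` C a| + #|` M| <= (#|` sumset (C a) M|).+1)%N).
  have RM := leq_sumsetl (R a) Mn0.
  have cRM : (#|` sumset (R a) M| <= #|` R a|)%N.
    by move: cAM; rewrite (card_sumset_split a) (card_split a); lia.
  have cCM : (#|` sumset (C a) M| < #|` C a| + #|` M|)%N.
    by move: cAM; rewrite (card_sumset_split a) (card_split a); lia.
  have perR := sumset_eq_periodic M0 cRM.
  have [C1|C1] := leqP #|` C a| 1.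
    (* Translation by [d] preserves [R a] and moves the single point of [C a]. *)
    right; exists d => //.
    apply: (@leq_trans #|` [fset a + d]|); last by rewrite cardfs1.
    apply/fsubset_leq_card/fsubsetP => x; rewrite in_fsetD mem_shift inE.
    move=> /andP[xA xdA]; have [/asboolP xda|/asboolP xda] := boolP (in_coset a (x - d)).
      have : (x - d) \in C a by rewrite !inE /= xdA; apply/asboolP.
      move: (Ca a aA); move: C1; rewrite leq_eqVlt ltnS leqn0 cardfs_eq0.
      move=> /orP[/cardfs1P[z ->]|/eqP -> //]; rewrite !inE => /eqP ->.
      by rewrite subr_eq.
    have : (x - d) \in R a by rewrite !inE /= xdA; apply/asboolP.
    rewrite -mem_shift perR ?inE; last exact: MK.
    by rewrite (negPf xA).
  have [finK cK] := coset_large C1 cCM.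
  left; exists (fset_set K); have sAK :
      (sumset A (fset_set K) `<=` shift (fset_set K) a `|` R a)%fset.
    apply/fsubsetP => y /mem_sumset[x [k [xA +]]].
    rewrite in_fset_set // inE => kK ->; rewrite inE subK //.
    apply/orP; have [/asboolP xa|/asboolP xa] := boolP (in_coset a x).
      by left; apply/asboolP; rewrite addrAC; exact: KD.
    right; rewrite -(perR k kK) mem_shift addrK !inE /= xA; exact/asboolP.
  have {sAK} := fsubset_leq_card sAK; rewrite cardfsU card_shift => sAK.
  split; [exact: gK|by exists d; first exact: dK| |].
    rewrite (card_split a); lia.
  by apply: (room_notin rAM); rewrite (card_sumset_split a); lia.
have small a : a \in A -> (#|` sumset (C a) M|.+1 < #|` C a| + #|` M|)%N.
  by move=> aA; rewrite ltnNge; apply/negP => ge; apply: all_small; exists a.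
have finK a : a \in A ->
    finite_set K /\ (#|` fset_set K| <= #|` sumset (C a) M|.+1)%N.
  move=> aA; have := small a aA => sma; apply: coset_large; last by lia.
  have Cn0 : C a != fset0 by apply/fset0Pn; exists a; exact: Ca.
  by have := leq_sumsetl M Cn0; rewrite sumsetC; lia.
have [a aA] := fset0Pn _ An0; have [fK _] := finK a aA.
have sAK : (sumset A (fset_set K) `<=` sumset A M)%fset.
  apply/fsubsetP => y /mem_sumset[b [k [bA +]]].
  rewrite in_fset_set // inE => kK yE; apply: contraT => yAM.
  pose D : {fset G} := [fset y - m | m in M].
  have cD : #|` D| = #|` M| by rewrite card_imfset // => ? ? /addrI/oppr_inj.
  have DK : (D `|` C b `<=` shift (fset_set K) b)%fset.
    apply/fsubsetP => x; rewrite inE subK // => /orP[/imfsetP[m /= mM ->]|].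
      apply/asboolP; rewrite yE addrAC [b + k]addrC addrK.
      exact: KD kK (KN (MK mM)).
    by rewrite !inE /= => /andP[_ /asboolP].
  have DC : (D `&` C b)%fset = fset0.
    apply/fsetP => x; rewrite inE in_fset0; apply/negP => /andP[].
    move=> /imfsetP[m /= mM ->]; rewrite !inE /= => /andP[ymA _].
    move/negP: yAM; apply; apply/mem_sumset; exists (y - m), m.
    by rewrite subrK.
  have := fsubset_leq_card DK; rewrite cardfsU DC cardfs0 subn0 cD card_shift.
  by have [_] := finK b bA; have := small b bA; lia.
left; exists (fset_set K); have cAK := fsubset_leq_card sAK.
split; [exact: gK|by exists d; first exact: dK| |].
  have MKf : (M `<=` fset_set K)%fset.
    by apply/fsubsetP => x xM; rewrite in_fset_set // inE; exact: MK.
  by have := fsubset_leq_card MKf; lia.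
by apply: (room_notin rAM); lia.
Qed.

End SidonAtom.

(** The set [B] shows that an atom [M] of [A] in the whole group has excess less
    than [#|A|]. If [M] is a subgroup, it is the period sought; if [M] is the pair
    [0], [d], then [A] and [A + d] nearly coincide; otherwise [M] is a Sidon set
    with at least three points. *)
Lemma critical_nearly (G : zmodType) (A B : {fset G}) : A != fset0 ->
  (2 <= #|` B|)%N -> (#|` sumset A B| < #|` A| + #|` B|)%N ->
  room [set: G] #|` sumset A B| -> nearly_periodic A \/ nearly_stable A.
Proof.
move=> An0 B2 cAB rAB; have sB : separated [set: G] A B by rewrite /separated sumsetC.
have [M [M0 [_ M2 rM] eM gsM]] :=
  atom_subgroup_or_sidon (@subgroupT G) (@subsetT _ _) An0 sB.
have Mn0 : M != fset0 by apply/fset0Pn; exists 0.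
have cAM : (#|` sumset A M| < #|` A| + #|` M|)%N.
  have := leq_sumsetl M An0; have := leq_sumsetl B An0; move: eM.
  by rewrite /excess ![sumset _ A]sumsetC; lia.
rewrite sumsetC in rM; have [d dM d0] := exists_nonzero M2.
case: gsM => [gM|sM].
  by left; exists M; split=> //; [exists d|apply: (room_notin rM)].
have [M3|M3] := ltnP 2 #|` M|; first exact: (sidon_atom M0 sM M3).
right; exists d => //.
have sub : (A `|` shift A d `<=` sumset A M)%fset.
  by apply/fsubUsetP; split; [apply: sub_sumset|apply: shift_sub_sumset].
have := fsubset_leq_card sub; rewrite cardfsU card_shift cardfsD card_shift.
have := fsubset_leq_card (fsubsetIl A (shift A d)).
by rewrite (fsetIC (shift A d)); lia.
Qed.

(** * Sets nearly stable under a translation *)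

Lemma natmul_torsion (G : zmodType) (R : {fset G}) (a d : G) :
  (forall i, a + d *+ i \in R) -> exists2 n, (0 < n)%N & d *+ n = 0.
Proof.
move=> aR; apply: contrapT => free.
pose s := [seq a + d *+ i | i <- iota 0 #|` R|.+1].
suff us : uniq s.
  have : {subset s <= enum_fset R} by move=> x /mapP[i _ ->]; apply: aR.
  by move=> /(uniq_leq_size us); rewrite size_map size_iota ltnn.
have inj i j : (i < j)%N -> d *+ i <> d *+ j.
  move=> ij e; apply: free; exists (j - i)%N; rewrite ?subn_gt0 //.
  by rewrite mulrnBr ?(ltnW ij) // e subrr.
rewrite map_inj_uniq ?iota_uniq // => i j /addrI e.
by case: (ltngtP i j) => // /inj[]; rewrite e.
Qed.

Lemma shift_natmul (G : zmodType) (R : {fset G}) (d : G) i :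
  shift R d = R -> shift R (d *+ i) = R.
Proof.
move=> Rd; elim: i => [|i IH]; apply/fsetP => x; rewrite mem_shift ?subr0 //.
by rewrite mulrS opprD addrA -mem_shift IH -mem_shift Rd.
Qed.

Definition multiples (G : zmodType) (d : G) n : {fset G} :=
  [fset d *+ i | i in iota 0 n].

Lemma mem_multiples (G : zmodType) (d x : G) n : (0 < n)%N -> d *+ n = 0 ->
  x \in multiples d n <-> exists i, x = d *+ i.
Proof.
move=> n0 dn; split=> [/imfsetP[i _ ->]|[i ->]]; first by exists i.
apply/imfsetP; exists (i %% n)%N; first by rewrite /= mem_iota ltn_mod n0.
by rewrite {1}(divn_eq i n) mulrnDr mulnC mulrnA dn mul0rn add0r.
Qed.

(** Any positive multiple [n] of the order of [d] serves, because [- d *+ j] is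
    [d *+ (j * n.-1)]. *)
Lemma subgroup_multiples (G : zmodType) (d : G) n : (0 < n)%N -> d *+ n = 0 ->
  subgroup [set` multiples d n].
Proof.
move=> n0 dn; have memP := @mem_multiples _ d _ n n0 dn.
apply: subgroupI => /= [|x y /memP[i ->] /memP[j ->]]; apply/memP.
  by exists 0%N.
exists (i + j * n.-1)%N; rewrite mulrnDr; congr (_ + _); apply/eqP.
by rewrite eq_sym -addr_eq0 addrC -mulrnDr -mulnS prednK // mulnC mulrnA dn mul0rn.
Qed.

Lemma cosetP (G : zmodType) (H : set G) (y x : G) : coset y H x <-> H (x - y).
Proof.
split=> [[h Hh <-]|Hxy]; first by rewrite addrAC subrr add0r.
by exists (x - y) => //; rewrite addrC subrK.
Qed.

Lemma coset_eq (G : zmodType) (H : set G) (x y : G) : subgroup H ->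
  H (x - y) -> coset x H = coset y H.
Proof.
move=> /subgroupP[_ HN HD] Hxy; apply/seteqP; split=> z /cosetP Hz; apply/cosetP.
  by have := HD _ _ Hz Hxy; rewrite addrA subrK.
by have := HD _ _ Hz (HN _ Hxy); rewrite opprB addrA subrK.
Qed.

(** The cosets other than that of [e] are listed by representatives, so that the
    index set is the one of the theorem. *)
Lemma enumerate_other_cosets (G : zmodType) (H : set G) (e : G) :
  subgroup H -> finite_set [set: G] ->
  exists n (g : 'I_n.-1 -> G),
    [/\ has_index H n,
        forall x, ~ coset e H x <-> exists i, coset (g i) H x
      & trivIset [set: 'I_n.-1] (fun i => coset (g i) H)].
Proof.
move=> gH finG; have [H0 _ _] := subgroupP gH.
have finC : finite_set (cosets H) by apply: finite_image.
have [n cn] := finC; pose E := (fset_set (cosets H) `\ coset e H)%fset.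
have cE : #|` E| = n.-1.
  have := cardfsD1 (coset e H) (fset_set (cosets H)).
  rewrite in_fset_set // mem_set; last by exists e.
  by rewrite (card_fset_set cn) => ->.
pose t i := nth (coset e H) (enum_fset E) i.
have tE (i : 'I_n.-1) : t i \in E by rewrite mem_nth // cE.
have self (x : G) : coset x H x by apply/cosetP; rewrite subrr.
have tP (i : 'I_n.-1) : coset (xget e (t i)) H = t i.
  have := tE i; rewrite in_fsetD1 => /andP[_]; rewrite in_fset_set // inE.
  move=> [y _ yE]; have /cosetP : coset y H (xget e (t i)).
    by rewrite yE; apply: xgetPex; exists y; rewrite -yE.
  by move=> /(coset_eq gH); rewrite yE.
exists n, (fun i => xget e (t i)); split=> //.
- move=> x; split=> [nx|[i]].
    have xE : coset x H \in E.
      rewrite in_fsetD1 in_fset_set // mem_set ?andbT; last by exists x.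
      by apply/eqP => xe; apply: nx; rewrite -xe.
    have := xE; rewrite -index_mem cE => lt; exists (Ordinal lt).
    by rewrite tP /t /= nth_index.
  rewrite tP => tx ex; have := tE i; rewrite in_fsetD1 => /andP[/eqP + _]; apply.
  move: tx; rewrite -tP => /cosetP /(coset_eq gH) <-.
  by move/cosetP: ex => /(coset_eq gH).
apply/trivIsetP => i j _ _ ij; apply/seteqP; split=> // x [].
move=> /cosetP/(coset_eq gH) + /cosetP/(coset_eq gH); rewrite !tP => -> /eqP.
by rewrite nth_uniq ?cE ?fset_uniq // => /eqP /val_inj ij'; rewrite ij' eqxx in ij.
Qed.

Lemma stable_subset_eq (G : zmodType) (R : {fset G}) d :
  (forall x, x \in R -> x + d \in R) -> shift R d = R.
Proof.
move=> Rd; apply/eqP; rewrite eqEfcard card_shift leqnn andbT.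
by apply/fsubsetP => x; rewrite mem_shift => /Rd; rewrite subrK.
Qed.

(** Here [e] is the only point at which [A] is left by adding [d]. Walk back from
    [e] in steps of [d] for as long as the walk stays in [A]: the points met form
    a progression [A0], and the rest [R] of [A] is stable, since a point of [R]
    followed by a point of [A0] would extend the walk. The walk cannot close up
    into a cycle, because it would reach [e + d], which is not in [A]. *)
Lemma nearly_stable_run (G : zmodType) (A : {fset G}) d e :
  e \in A -> e + d \notin A -> (forall x, x \in A -> x + d \notin A -> x = e) ->
  exists A0 R : {fset G},
    [/\ arith_prog [set` A0],
        e \in A0 /\ forall x, x \in A0 -> exists i, x = e - d *+ i,
        A = (A0 `|` R)%fset, [disjoint A0 & R]%fset & shift R d = R].
Proof.
move=> eA edA ex_uniq.
have loop n : (0 < n)%N -> d *+ n = 0 -> e - d *+ n.-1 \notin A.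
  move=> n0 dn; have <- : e + d = e - d *+ n.-1 => //; apply/eqP.
  by rewrite -subr_eq0 opprB addrA -[e + d + _]addrA -mulrS prednK // dn addr0 subrr.
have ex_out : exists k, e - d *+ k \notin A.
  apply: contrapT => all_in.
  have in_A i : e - d *+ i \in A.
    by apply: contraT => out; case: all_in; exists i.
  have [|n n0 dn] := @natmul_torsion _ A e (- d).
    by move=> i; rewrite mulNrn.
  by have := loop n n0; rewrite in_A -[d]opprK mulNrn dn oppr0 => /(_ erefl).
have [k kA kmin] := ex_minnP ex_out.
have k_gt0 : (0 < k)%N by case: k kA {kmin} => //; rewrite subr0 eA.
have inA i : (i < k)%N -> e - d *+ i \in A.
  by move=> ik; apply: contraT => /kmin; rewrite leqNgt ik.
pose A0 : {fset G} := [fset e - d *+ i | i in iota 0 k].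
have A0P x : x \in A0 <-> exists2 i, (i < k)%N & x = e - d *+ i.
  split=> [/imfsetP[i /=]|[i ik ->]]; first by rewrite mem_iota /= => ik ->; exists i.
  by apply/imfsetP; exists i; rewrite //= mem_iota.
exists A0, (A `\` A0)%fset; split.
- exists (e - d *+ k), d, k; split=> // [n [n0 dn _]|].
    by have := kmin _ (loop n n0 dn); lia.
  have step i : (i <= k)%N -> e - d *+ k + d *+ i = e - d *+ (k - i).
    by move=> ik; rewrite mulrnBr // opprB addrA addrAC.
  apply/seteqP; split=> [x /= /A0P[i ik ->]|x /= [i /= /andP[i0 ik] <-]].
    by exists (k - i)%N; rewrite /= ?step; [lia|congr (_ - _ *+ _); lia|lia].
  by rewrite step //; apply/A0P; exists (k - i)%N => //; lia.
- split; first by apply/A0P; exists 0%N; rewrite ?subr0.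
  by move=> x /A0P[i _ ->]; exists i.
- apply/fsetP => x; rewrite in_fsetU in_fsetD; have [/A0P[i ik ->]|//] := boolP (x \in A0).
  by rewrite inA.
- by apply/fdisjointP => x xA0; rewrite in_fsetD xA0.
apply: stable_subset_eq => r; rewrite !in_fsetD => /andP[rA0 rA].
have nre : r != e.
  by apply: contra rA0 => /eqP ->; apply/A0P; exists 0%N; rewrite ?subr0.
rewrite andbC; have [rdA /=|/(ex_uniq _ rA)/eqP] := boolP (r + d \in A); last first.
  by rewrite (negPf nre).
apply/negP => /A0P[i ik] /(canRL (addrK d)) re.
have {}re : r = e - d *+ i.+1 by rewrite re mulrS opprD addrA addrAC.
have [ik'|ik'] := ltnP i.+1 k.
  by move/negP: rA0; apply; apply/A0P; exists i.+1.
by move: kA; have -> : k = i.+1 by [lia]; rewrite -re rA.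
Qed.

Definition cosets_and_progression (G : zmodType) (A : {fset G}) : Prop :=
  exists (H : set G) (n : nat) (g : 'I_n.-1 -> G) (A0 : set G),
     [/\ subgroup H /\ H <> [set 0],
         has_index H n,
         arith_prog A0 /\ A0 `<=` [set` A],
         [set` A] = A0 `|` \bigcup_(i in [set: 'I_n.-1]) coset (g i) H
       & trivIset [set: 'I_n.-1] (fun i => coset (g i) H) /\
         (forall i : 'I_n.-1, A0 `&` coset (g i) H = set0)].

(** A progression alone is the case where the subgroup is the whole group, of
    index one. *)
Lemma arith_prog_whole (G : zmodType) (A : {fset G}) (d : G) :
  d != 0 -> arith_prog [set` A] -> cosets_and_progression A.
Proof.
move=> d0 apA; exists [set: G], 1%N, (fun=> 0), [set` A].
have cT (y : G) : coset y [set: G] = [set: G].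
  by apply/seteqP; split=> // x _; apply/cosetP.
split.
- split; first exact: subgroupT.
  by move/seteqP=> [/(_ d I) /= /eqP]; rewrite (negPf d0).
- rewrite /has_index (_ : cosets _ = [set [set: G]]); last first.
    apply/seteqP; split=> [C [y _ <-]|C ->]; first exact: cT.
    by exists 0 => //; apply: cT.
  by apply/fcard_eq => //; rewrite fset_set1 cardfs1 (card_fset_set (card_eqxx _)).
- by split=> // x.
- by apply/seteqP; split=> [x|x [//|[[]]]]; first by left.
by split=> [|[]//]; apply/trivIsetP => [[]].
Qed.

(** Write [A] as a progression [A0] ending at [e] and a set [R] stable under [d].
    If [d] has infinite order, the finite set [R] is empty. Otherwise let [H] be
    the finite subgroup generated by [d]: [R] is a union of cosets of [H], and
    [A0] lies in the coset of [e]. Either [A + H] is proper and [A] is nearly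
    periodic, or [R] consists of all cosets other than that of [e]. *)
Lemma nearly_stable_structure (G : zmodType) (A : {fset G}) : A != fset0 ->
  (exists x, x \notin A) -> nearly_stable A ->
  nearly_periodic A \/ cosets_and_progression A.
Proof.
move=> An0 [y yA] [d d0 dA].
have cyclic n (R : {fset G}) : (0 < n)%N -> d *+ n = 0 -> shift R d = R ->
    forall x h, h \in multiples d n -> (x + h \in R) = (x \in R).
  move=> n0 dn Rd x h /(mem_multiples _ n0 dn)[i ->].
  by rewrite -{1}(shift_natmul i Rd) mem_shift addrK.
have dH n : (0 < n)%N -> d *+ n = 0 -> d \in multiples d n.
  by move=> n0 dn; apply/mem_multiples => //; exists 1%N.
have [Ad|] := pselect (forall x, x \in A -> x + d \in A).
  have stA := stable_subset_eq Ad; have /fset0Pn[a aA] := An0.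
  have [|n n0 dn] := @natmul_torsion _ A a d.
    by move=> i; rewrite -(shift_natmul i stA) mem_shift addrK.
  left; exists (multiples d n).
  have AH : (sumset A (multiples d n) `<=` A)%fset.
    apply/fsubsetP => x /mem_sumset[b [h [bA hH ->]]].
    by rewrite (cyclic _ _ n0 dn stA).
  split; first exact: subgroup_multiples.
  - by exists d => //; apply: dH.
  - have := fsubset_leq_card AH; have : multiples d n != fset0.
      by apply/fset0Pn; exists d; apply: dH.
    by rewrite -cardfs_gt0; lia.
  by exists y; apply: contra yA; apply: (fsubsetP AH).
move=> /existsNP[e /not_implyP[eA /negP edA]].
have [|A0 [R [apA0 [eA0 A0e] AE dis Rd]]] := nearly_stable_run eA edA.
  move=> x xA xdA; apply/(addIr d).
  have out z : z \in A -> z + d \notin A -> z + d \in (shift A d `\` A)%fset.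
    by move=> zA zdA; rewrite in_fsetD zdA mem_shift addrK.
  move: dA (out x xA xdA) (out e eA edA); rewrite leq_eqVlt ltnS leqn0 cardfs_eq0.
  by move=> /orP[/cardfs1P[z ->]|/eqP -> //]; rewrite !inE => /eqP -> /eqP ->.
have [torsion|free] := pselect (exists2 n, (0 < n)%N & d *+ n = 0); last first.
  right; apply: (arith_prog_whole d0); suff <- : A0 = A by [].
  rewrite AE; have [->|/fset0Pn[r rR]] := eqVneq R fset0; first by rewrite fsetU0.
  case: free; apply: (@natmul_torsion _ R r) => i.
  by rewrite -(shift_natmul i Rd) mem_shift addrK.
have [n n0 dn] := torsion; set H := multiples d n.
have cycR := cyclic n R n0 dn Rd; have gH := subgroup_multiples n0 dn.
have [H0 HN HD] := subgroupP gH.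
have A0H x : x \in A0 -> x - e \in H.
  move=> /A0e[i ->]; rewrite addrAC subrr add0r; apply: HN.
  by apply/mem_multiples => //; exists i.
have eR : e \notin R by move/fdisjointP: dis; apply.
have sAH : (sumset A H `<=` shift H e `|` R)%fset.
  apply/fsubsetP => x /mem_sumset[a [h [+ hH ->]]].
  rewrite AE in_fsetU => /orP[/A0H aH|aR]; rewrite in_fsetU mem_shift.
    by rewrite addrAC (HD _ _ aH hH).
  by rewrite cycR // aR orbT.
have [nfull|full] := pselect (exists x, x \notin sumset A H).
  left; exists H; split=> //; first by exists d => //; apply: dH.
  have := fsubset_leq_card sAH; rewrite cardfsU card_shift.
  have : (e |` R `<=` A)%fset by rewrite fsubUset fsub1set eA AE fsubsetUr.
  by move=> /fsubset_leq_card; rewrite cardfsU1 eR; lia.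
have memR x : x \in R <-> ~ coset e [set` H] x.
  split=> [xR /cosetP /= xeH|nx].
    by move/negP: eR; apply; rewrite -(cycR e _ xeH) addrC subrK.
  have : x \in sumset A H by apply: contraT => xAH; case: full; exists x.
  move=> /(fsubsetP sAH); rewrite in_fsetU mem_shift => /orP[xe|//].
  by case: nx; apply/cosetP.
have finG : finite_set [set: G].
  suff -> : [set: G] = [set` sumset A H] by exact: finite_fset.
  apply/seteqP; split=> // x _ /=; apply: contraT => xAH.
  by case: full; exists x.
have [m [g [iH gE gtriv]]] := enumerate_other_cosets e gH finG.
right; exists [set` H], m, g, [set` A0]; split=> //.
- split=> // /seteqP[/(_ d) /= + _] => /(_ (dH n n0 dn))/eqP.
  by rewrite (negPf d0).
- by split=> // x /=; rewrite AE in_fsetU => ->.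
- apply/seteqP; split=> x /=; rewrite AE in_fsetU.
    by move=> /orP[|/memR/gE[i xi]]; [left|right; exists i].
  move=> [->//|[i _ xi]]; apply/orP; right.
  by apply/memR/gE; exists i.
split=> // i; apply/seteqP; split=> // x [/= xA0 xi].
have : x \in R by apply/memR/gE; exists i.
by apply/negP; move/fdisjointP: dis; apply.
Qed.

Theorem theorem4 (G : zmodType) (A B : {fset G})
    (hAB : (#|` sumset A B| <= #|` A| + #|` B| - 1)%N)
    (hA : A <> fset0)
    (hB : (2 <= #|` B|)%N)
    (hG : finite_set [set: G] ->
          (#|` sumset A B| + 2 <= #|` fset_set [set: G]|)%N) :
  (exists H : {fset G},
     [/\ subgroup [set` H],
         [set` H] `<` [set: G],
         [set` H] <> [set 0],
         (#|` sumset A H| - #|` A| <= #|` H| - 1)%N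
       & [set` sumset A H] <> [set: G]])
  \/
  (exists (H : set G) (n : nat) (g : 'I_n.-1 -> G) (A0 : set G),
     [/\ subgroup H /\ H <> [set 0],
         has_index H n,
         arith_prog A0 /\ A0 `<=` [set` A],
         [set` A] = A0 `|` \bigcup_(i in [set: 'I_n.-1]) coset (g i) H
       & trivIset [set: 'I_n.-1] (fun i => coset (g i) H) /\
         (forall i : 'I_n.-1, A0 `&` coset (g i) H = set0)]).
Proof.
have An0 : A != fset0 by apply/eqP.
have cAB : (#|` sumset A B| < #|` A| + #|` B|)%N by lia.
suff [[H [gH [d dH d0] cAH [x xAH]]]|?] : nearly_periodic A \/ cosets_and_progression A.
- left; exists H; split=> //; last 2 first.
  + by lia.
  + by move=> /seteqP[_ /(_ x I) /=]; apply/negP.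
  + split=> // GH; have /fset0Pn[a aA] := An0; move/negP: xAH; apply.
    apply/mem_sumset; exists a, (x - a); rewrite addrCA subrr addr0; split=> //.
    exact: GH.
  + by move=> /seteqP[/(_ d dH) /= /eqP]; rewrite (negPf d0).
- by right.
have [|nsA] := critical_nearly An0 hB cAB hG; first by left.
apply: nearly_stable_structure => //.
have [x xAB] := room_notin hG (leqnSn _).
have /fset0Pn[b bB] : B != fset0 by rewrite -cardfs_gt0; lia.
exists (x - b); apply: contra xAB => xA.
by apply/mem_sumset; exists (x - b), b; rewrite subrK.
Qed.
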